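(* Let $\overline\Gamma=\langle a,t\rangle$ and let $K=\langle x,y\rangle$ be the subgroup of $\overline\Gamma$ generated by $x=ta^{-1}$ and $y=a^{-1}t$. Then $K$ is torsion-free; thus $\overline\Gamma$ is virtually torsion-free.
   Context: Let $\mathcal T_3=\{0,1,2\}^*$ be the ternary rooted tree; automorphisms act on the left on finite words. For a letter $x$ let $\overline x=x+1\bmod 3$. The automorphism $a$ is given by $a(x\sigma)=\overline x\sigma$. The automorphism $t$ is defined recursively (fixing all first-level vertices) by $t(0x\sigma)=0\overline x\sigma$, $t(1x\sigma)=1\overline x\sigma$, $t(2\sigma)=2t(\sigma)$. $\overline\Gamma$ is the subgroup of $\operatorname{Aut}(\mathcal T_3)$ generated by $a$ and $t$ (the bar is just part of the name). A group is virtually torsion-free if it has a torsion-free subgroup of finite index. *)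

(* Defs.v *)
From HB Require Import structures.
From mathcomp Require Import all_boot.
From mathcomp Require Import boolp classical_sets cardinality.

Set Implicit Arguments.
Unset Strict Implicit.
Unset Printing Implicit Defensive.

Local Open Scope group_scope.
Local Open Scope classical_set_scope.

Section GroupNotions.
Variable G : groupType.
Implicit Types H K S : set G.

Definition is_subgroup H : Prop := group_closed (mem H).

Definition generated S : set G := smallest is_subgroup S.

Definition torsion_free H : Prop :=
  forall g : G, H g -> forall n : nat, (0 < n)%N -> g ^+ n = 1 -> g = 1.

Definition left_coset (g : G) H : set G := [set g * h | h in H].

Definition finite_index K H : Prop := finite_set [set left_coset g H | g in K].

Definition virtually_torsion_free K : Prop :=
  exists H, [/\ is_subgroup H, H `<=` K, finite_index K H & torsion_free H].

End GroupNotions.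

Definition letter : finType := 'I_3.

(* The vertices of the ternary rooted tree; the root is [::]. *)
Definition word : Type := seq letter.

Definition child (u v : word) : bool := [exists x : letter, v == rcons u x].

Definition edge (u v : word) : bool := child u v || child v u.

Definition tree_automorphism (f : word -> word) : Prop :=
  [/\ bijective f, f [::] = [::] & forall u v, edge (f u) (f v) = edge u v].

Record tree_aut : Type :=
  TreeAut { aut_fun :> word -> word; _ : `[< tree_automorphism aut_fun >] }.

HB.instance Definition _ := [isSub for aut_fun].
HB.instance Definition _ := [Choice of tree_aut by <:].

Lemma tree_autP (f : tree_aut) : tree_automorphism f.
Proof. by case: f => f /= /asboolP. Qed.

Definition mk_tree_aut (f : word -> word) (fP : tree_automorphism f) : tree_aut :=
  TreeAut (introT (asboolP _) fP).

Lemma tree_aut_ext (f g : tree_aut) : (forall w, f w = g w) -> f = g.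
Proof. by move=> fg; apply/val_inj/funext. Qed.

Fact id_automorphism : tree_automorphism id.
Proof. by split=> //; exists id. Qed.

Fact comp_automorphism (f g : tree_aut) : tree_automorphism (fun w => f (g w)).
Proof.
have [bf f0 fe] := tree_autP f; have [bg g0 ge] := tree_autP g.
by split; [exact: bij_comp | rewrite g0 | move=> u v; rewrite fe ge].
Qed.

Fact inv_exists (f : tree_aut) :
  exists g : word -> word, cancel f g /\ cancel g f.
Proof. by have [[g fK gK] _ _] := tree_autP f; exists g. Qed.

Definition inv_fun (f : tree_aut) : word -> word := projT1 (cid (inv_exists f)).

Fact inv_funK (f : tree_aut) : cancel f (inv_fun f).
Proof. by rewrite /inv_fun; case: cid => g []. Qed.

Fact inv_funVK (f : tree_aut) : cancel (inv_fun f) f.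
Proof. by rewrite /inv_fun; case: cid => g []. Qed.

Fact inv_automorphism (f : tree_aut) : tree_automorphism (inv_fun f).
Proof.
have [_ f0 fe] := tree_autP f; split.
- by exists f; [exact: inv_funVK | exact: inv_funK].
- by rewrite -{1}f0 inv_funK.
- by move=> u v; rewrite -fe !inv_funVK.
Qed.

Definition tree_aut_one : tree_aut := mk_tree_aut id_automorphism.
Definition tree_aut_inv (f : tree_aut) : tree_aut :=
  mk_tree_aut (inv_automorphism f).
(* Automorphisms act on the left: (f * g) w = f (g w). *)
Definition tree_aut_mul (f g : tree_aut) : tree_aut :=
  mk_tree_aut (comp_automorphism f g).

Fact tree_aut_mulA : associative tree_aut_mul.
Proof. by move=> f g h; apply: tree_aut_ext. Qed.
Fact tree_aut_mul1 : left_id tree_aut_one tree_aut_mul.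
Proof. by move=> f; apply: tree_aut_ext. Qed.
Fact tree_aut_mulr1 : right_id tree_aut_one tree_aut_mul.
Proof. by move=> f; apply: tree_aut_ext. Qed.
Fact tree_aut_mulV : left_inverse tree_aut_one tree_aut_inv tree_aut_mul.
Proof. by move=> f; apply: tree_aut_ext => w /=; rewrite inv_funK. Qed.
Fact tree_aut_mulrV : right_inverse tree_aut_one tree_aut_inv tree_aut_mul.
Proof. by move=> f; apply: tree_aut_ext => w /=; rewrite inv_funVK. Qed.

HB.instance Definition _ := isGroup.Build tree_aut
  tree_aut_mulA tree_aut_mul1 tree_aut_mulr1 tree_aut_mulV tree_aut_mulrV.

(* [ordS x] is x + 1 mod 3. *)
Definition a_fun (w : word) : word :=
  if w is x :: s then ordS x :: s else [::].

Fixpoint t_fun (w : word) : word :=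
  if w is x :: s then
    x :: (if val x == 2 then t_fun s else a_fun s)
  else [::].

Fact order3_automorphism (f : word -> word) :
    (forall w, f (f (f w)) = w) -> f [::] = [::] ->
    (forall u v, child u v -> child (f u) (f v)) -> tree_automorphism f.
Proof.
move=> f3 f0 fC; have fE u v : child (f u) (f v) = child u v.
  by apply/idP/idP; [move=> /fC/fC; rewrite !f3 | exact: fC].
by split=> //; [exists (fun w => f (f w)) | move=> u v; rewrite /edge !fE].
Qed.

Fact child_cons x u v : child (x :: u) (x :: v) = child u v.
Proof. by apply: eq_existsb => y; rewrite /= eqseq_cons eqxx. Qed.

Fact ordS3 (x : letter) : ordS (ordS (ordS x)) = x.
Proof. by apply/val_inj; case: x => [[|[|[|]]]]. Qed.

Fact a_fun3 w : a_fun (a_fun (a_fun w)) = w.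
Proof. by case: w => //= x s; rewrite ordS3. Qed.

Fact child_a_fun u v : child u v -> child (a_fun u) (a_fun v).
Proof.
move=> /existsP[y /eqP->]; apply/existsP.
by case: u => [|x s] /=; [exists (ordS y) | exists y].
Qed.

Fact a_automorphism : tree_automorphism a_fun.
Proof.
by apply: order3_automorphism => //; [exact: a_fun3 | exact: child_a_fun].
Qed.

Fact t_automorphism : tree_automorphism t_fun.
Proof.
apply: order3_automorphism => //.
- elim=> //= x s IH; congr (x :: _).
  by case: eqP => _ //=; rewrite a_fun3.
- elim=> [|x u IH] v.
    by move=> /existsP[y /eqP->] /=; apply/existsP; exists y; case: ifP.
  case: v => [|z v]; first by move=> /existsP[].
  move=> uv; have zx : z = x.
    by move/existsP: uv => [y]; rewrite /= eqseq_cons => /andP[/eqP].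
  move: uv; rewrite zx child_cons /= child_cons => uv.
  by case: eqP => _; [exact: IH | exact: child_a_fun].
Qed.

Definition a : tree_aut := mk_tree_aut a_automorphism.
Definition t : tree_aut := mk_tree_aut t_automorphism.

Definition GammaBar : set tree_aut := generated [set a; t].

Definition x : tree_aut := t * a^-1.
Definition y : tree_aut := a^-1 * t.

Definition K : set tree_aut := generated [set x; y].

(* Main.v *)
From mathcomp Require Import all_boot all_algebra ring.
From mathcomp Require Import boolp classical_sets cardinality.
Require Import Defs.

(** Every element f of the group generated by a and t rotates the first level
by some amount [rot f] in Z/3, which is the exponent of a in f, and has three
sections f_0, f_1, f_2 (its actions below the vertices 0, 1, 2) that lie again
in the group. The decomposition t = (a, a, t) makes the exponent [texp f] of t
in f, modulo 3, visible on the tree as well: it is minus the sum of the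
rotations of the three sections. Both exponents are therefore homomorphisms to
Z/3, and so is their sum [expsum f]. Checking the generators, where
a = (1, 1, 1) followed by a rotation, gives the identity behind the whole proof,
<<
    expsum f_i = texp f    for i = 0, 1, 2       (expsum_section).
>>
Let N be the kernel of expsum. It contains K, since x and y are quotients of t
and a, and its index is at most 3. It is torsion-free for the following reason.

- An element f of N with nonzero rotation has infinite order
  (rot_neq0_order). An exponent n with f^n = 1 must be a multiple of 3; the
  cube of f fixes the first level, and its section at 0 is a product of the
  three sections of f. By the identity above that section is again in N, and
  its rotation is minus texp f, that is rot f, which is not 0 (cube_section).
  So the section would be killed by n/3, and one descends.

- Hence a torsion element f of N fixes the first level, so that texp f = 0. By
  the identity its sections are again torsion elements of N, and by induction
  on the length of a word f fixes all words. *)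

Set Implicit Arguments.
Unset Strict Implicit.
Unset Printing Implicit Defensive.

Import GRing.Theory.
Local Open Scope ring_scope.
Local Open Scope classical_set_scope.

(** * Generated subgroups *)

Section GeneratedSubgroup.
Variable G : groupType.
Implicit Types S : set G.

Lemma generated_subgroup S : is_subgroup (generated S).
Proof.
split=> [|f g]; first by rewrite inE => H [[H1 _] _]; move: H1; rewrite inE.
rewrite !inE => Sf Sg H HS; have [[_ Hdiv] _] := HS.
by have := Hdiv f g; rewrite !inE; apply; [exact: Sf | exact: Sg].
Qed.

Lemma generated_ind S (P : G -> Prop) :
    P 1%g -> (forall f g, P f -> P g -> P (f * g^-1)%g) ->
    (forall f, S f -> P f) -> forall f, generated S f -> P f.
Proof.
move=> P1 Pdiv PS f; apply: (@smallest_sub _ _ _ [set f | P f]) => //.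
by split=> [|g h]; rewrite !inE //; exact: Pdiv.
Qed.

End GeneratedSubgroup.

Lemma GammaBar1 : GammaBar 1%g.
Proof. by have [H _] := generated_subgroup [set a; t]; rewrite inE in H. Qed.

Lemma GammaBarM f g : GammaBar f -> GammaBar g -> GammaBar (f * g)%g.
Proof.
have /group_closedM H := generated_subgroup [set a; t].
by move=> Gf Gg; have := H f g; rewrite !inE; apply.
Qed.

Lemma GammaBarV f : GammaBar f -> GammaBar f^-1%g.
Proof.
have /group_closedV H := generated_subgroup [set a; t].
by move=> Gf; have := H f; rewrite !inE; apply.
Qed.

Lemma GammaBar_a : GammaBar a.
Proof. by apply: sub_gen_smallest; left. Qed.

Lemma GammaBar_t : GammaBar t.
Proof. by apply: sub_gen_smallest; right. Qed.

(** * Rotations and sections *)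

Definition rot (f : tree_aut) : 'Z_3 := head 0 (f [:: 0 : 'Z_3]).

(** The wreath recursion: s i is the section of f at the vertex i. Such an s
exists only if f acts on the first level as a rotation. *)
Definition wreath (f : tree_aut) (s : 'Z_3 -> tree_aut) : Prop :=
  forall (i : 'Z_3) (w : word), f (i :: w) = (i + rot f) :: s i w.

Lemma ordS_Z3 (i : 'Z_3) : ordS i = i + 1.
Proof. by apply/val_inj; case: i => [[|[|[|]]]]. Qed.

Lemma wreath1 : wreath 1%g (fun=> 1%g).
Proof. by move=> i w; rewrite [rot _]/= addr0. Qed.

Lemma wreath_a : wreath a (fun=> 1%g).
Proof.
move=> i w; have -> : rot a = 1 by apply/val_inj.
by rewrite -ordS_Z3.
Qed.

Lemma wreath_t : wreath t (fun i => if val i == 2 then t else a).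
Proof. by move=> i w; rewrite [rot _]/= addr0 /=; case: ifP. Qed.

Lemma wreathM f g s u : wreath f s -> wreath g u ->
  rot (f * g)%g = rot f + rot g /\
  wreath (f * g)%g (fun i => s (i + rot g) * u i)%g.
Proof.
move=> fs gu; have fgE i w :
    (f * g)%g (i :: w) = (i + (rot f + rot g)) :: (s (i + rot g) * u i)%g w.
  by rewrite [LHS]/= gu fs; congr (_ :: _); ring.
have E : rot (f * g)%g = rot f + rot g by rewrite {1}/rot fgE add0r.
by split=> // i w; rewrite fgE E.
Qed.

(** The inverse of f reaches the vertex i from i - rot f, hence the shift of the
index. *)
Lemma wreathV f s : wreath f s ->
  rot f^-1%g = - rot f /\ wreath f^-1%g (fun i => (s (i - rot f))^-1)%g.
Proof.
move=> fs; have fVE i w :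
    f^-1%g (i :: w) = (i - rot f) :: (s (i - rot f))^-1%g w.
  apply: (can_inj (inv_funK f)).
  by rewrite fs subrK (inv_funVK f) (inv_funVK (s _)).
have E : rot f^-1%g = - rot f by rewrite {1}/rot fVE add0r.
by split=> // i w; rewrite fVE E.
Qed.

Lemma wreathX f s n : wreath f s -> rot f = 0 ->
  rot (f ^+ n)%g = 0 /\ wreath (f ^+ n)%g (fun i => s i ^+ n)%g.
Proof.
move=> fs f0; elim: n => [|n [IH0 IH]].
  by rewrite expg0; split=> //; exact: wreath1.
rewrite expgS; have [-> fgE] := wreathM fs IH.
rewrite IH0 f0 addr0; split=> // i w.
by rewrite fgE IH0 addr0 expgS.
Qed.

Lemma wreath_inj f s u i : wreath f s -> wreath f u -> s i = u i.
Proof.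
by move=> fs fu; apply: tree_aut_ext => w; move: (fs i w); rewrite fu => -[].
Qed.

Lemma GammaBar_wreath f : GammaBar f ->
  exists2 s, wreath f s & forall i, GammaBar (s i).
Proof.
move: f; apply: generated_ind.
- by exists (fun=> 1%g) => [|_]; [exact: wreath1 | exact: GammaBar1].
- move=> f g [s fs Gs] [u gu Gu]; have [_ gVu] := wreathV gu.
  have [_ fgE] := wreathM fs gVu; eexists; first exact: fgE.
  by move=> i /=; apply: GammaBarM => //; exact: GammaBarV.
- move=> _ [->|->].
    by exists (fun=> 1%g) => [|_]; [exact: wreath_a | exact: GammaBar1].
  exists (fun i => if val i == 2 then t else a); first exact: wreath_t.
  by move=> i; case: ifP => _; [exact: GammaBar_t | exact: GammaBar_a].
Qed.

Lemma rotM f g : GammaBar f -> GammaBar g -> rot (f * g)%g = rot f + rot g.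
Proof.
move=> /GammaBar_wreath[s fs _] /GammaBar_wreath[u gu _].
by have [] := wreathM fs gu.
Qed.

Lemma rotV f : GammaBar f -> rot f^-1%g = - rot f.
Proof. by move=> /GammaBar_wreath[s fs _]; have [] := wreathV fs. Qed.

Lemma rotX f n : GammaBar f -> rot (f ^+ n)%g = rot f *+ n.
Proof.
move=> Gf; suff [] : GammaBar (f ^+ n)%g /\ rot (f ^+ n)%g = rot f *+ n by [].
elim: n => [|n [Gfn IH]]; first by rewrite expg0; split=> //; exact: GammaBar1.
by rewrite expgS mulrS rotM // IH; split=> //; exact: GammaBarM.
Qed.

(** * The exponent homomorphisms *)

(** The number of occurrences of t, counted with signs modulo 3, in a word in a
and t that represents f. It is read off from the action on the second level,
so that it does not depend on the word: a contributes no rotation there, and t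
contributes two, of 1 each, with -2 = 1 modulo 3. *)
Definition texp (f : tree_aut) : 'Z_3 :=
  - \sum_(i : 'Z_3) nth 0 (f [:: i; 0 : 'Z_3]) 1.

Lemma texpE f s : wreath f s -> texp f = - \sum_i rot (s i).
Proof.
move=> fs; congr (- _); apply: eq_bigr => i _.
by rewrite fs /= /rot nth0.
Qed.

(** Composition permutes the sections, which a sum over all of them cannot
see. *)
Lemma texpM f g : GammaBar f -> GammaBar g -> texp (f * g)%g = texp f + texp g.
Proof.
move=> /GammaBar_wreath[s fs Gs] /GammaBar_wreath[u gu Gu].
have [_ fgE] := wreathM fs gu; rewrite (texpE fs) (texpE gu) (texpE fgE).
under eq_bigr => i _ do rewrite rotM //.
rewrite big_split /= opprD; congr (- _ - _).
by rewrite [RHS](reindex_inj (addIr (rot g))).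
Qed.

Lemma texp1 : texp 1%g = 0.
Proof. by rewrite (texpE wreath1) big1 ?oppr0. Qed.

Lemma texpV f : GammaBar f -> texp f^-1%g = - texp f.
Proof.
move=> Gf; apply/eqP; rewrite -addr_eq0 -texpM ?mulVg ?texp1 //.
exact: GammaBarV.
Qed.

Lemma texp_a : texp a = 0.
Proof. by rewrite (texpE wreath_a) big1 ?oppr0. Qed.

Lemma texp_t : texp t = 1.
Proof. by rewrite (texpE wreath_t) !big_ord_recl big_ord0; apply/val_inj. Qed.

Definition expsum (f : tree_aut) : 'Z_3 := rot f + texp f.

Lemma expsumM f g :
  GammaBar f -> GammaBar g -> expsum (f * g)%g = expsum f + expsum g.
Proof. by move=> Gf Gg; rewrite /expsum rotM // texpM //; ring. Qed.

Lemma expsumV f : GammaBar f -> expsum f^-1%g = - expsum f.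
Proof. by move=> Gf; rewrite /expsum rotV // texpV //; ring. Qed.

(** Sections of a product are products of sections, so that both sides are
homomorphic in f and the generators decide: the sections of a are trivial and
texp a = 0, while those of t are a, a and t, whose exponent sum is 1 = texp t. *)
Lemma expsum_section f s i : GammaBar f -> wreath f s ->
  GammaBar (s i) /\ expsum (s i) = texp f.
Proof.
move=> Gf fs; suff [u [fu Gu Eu]] : exists u,
    [/\ wreath f u, forall i, GammaBar (u i) & forall i, expsum (u i) = texp f].
  by rewrite (wreath_inj i fs fu).
suff [_ //] : GammaBar f /\ exists u,
    [/\ wreath f u, forall i, GammaBar (u i) & forall i, expsum (u i) = texp f].
move: f Gf {s i fs}; apply: generated_ind.
- split; first exact: GammaBar1.
  exists (fun=> 1%g); split=> [|_|_]; [exact: wreath1 | exact: GammaBar1 |].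
  by rewrite /expsum texp1 addr0.
- move=> f g [Gf [s [fs Gs Es]]] [Gg [u [gu Gu Eu]]].
  have GgV := GammaBarV Gg; split; first exact: GammaBarM.
  have [_ gVu] := wreathV gu; have [_ fgE] := wreathM fs gVu.
  eexists; split; first exact: fgE.
    by move=> i; apply: GammaBarM => //; exact: GammaBarV.
  move=> i; rewrite expsumM //; last exact: GammaBarV.
  by rewrite expsumV // Es Eu texpM // texpV.
- move=> _ [->|->].
    split; first exact: GammaBar_a.
    exists (fun=> 1%g); split=> [|_|_]; [exact: wreath_a | exact: GammaBar1 |].
    by rewrite /expsum texp1 texp_a addr0.
  split; first exact: GammaBar_t.
  exists (fun i => if val i == 2 then t else a); split; first exact: wreath_t.
    by move=> i; case: ifP => _; [exact: GammaBar_t | exact: GammaBar_a].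
  move=> i; case: ifP => _; rewrite /expsum texp_t ?texp_a; exact/val_inj.
Qed.

(** * The kernel of the exponent sum *)

Definition expsum_kernel : set tree_aut :=
  [set f | GammaBar f /\ expsum f = 0].

Lemma expsum_kernel_subgroup : is_subgroup expsum_kernel.
Proof.
split=> [|f g]; rewrite !inE.
  by split; [exact: GammaBar1 | rewrite /expsum texp1 addr0].
move=> [Gf Ef] [Gg Eg]; have GgV := GammaBarV Gg.
by split; [exact: GammaBarM | rewrite expsumM // expsumV // Ef Eg subrr].
Qed.

Lemma mulrn_eq0_Z3 (r : 'Z_3) n : r != 0 -> r *+ n = 0 -> (3 %| n)%N.
Proof.
move=> r0 rn; have rr : r * r = 1.
  by apply/val_inj; case: r r0 {rn} => [[|[|[|]]]].
(* Multiplying r *+ n by r, which is its own inverse, leaves n modulo 3. *)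
have : (n%:R : 'Z_3) = 0 by rewrite -rr -mulrnAr rn mulr0.
by move/(congr1 val); rewrite /= val_Zp_nat // /dvdn => ->.
Qed.

Lemma mulr3n_Z3 (r : 'Z_3) : r *+ 3 = 0.
Proof. by apply/val_inj; case: r => [[|[|[|]]]]. Qed.

(** Every nonzero r generates Z/3. The terms run backwards along the orbit of 0
under the rotation by r, as the sections do in a product of automorphisms. *)
Lemma sum_Z3 (F : 'Z_3 -> 'Z_3) (r : 'Z_3) :
  r != 0 -> \sum_i F i = F (r + r) + (F r + F 0).
Proof.
move=> r0; have r2 : r + r != 0 by case: r r0 => [[|[|[|]]]].
rewrite (bigD1 (r + r)) // (bigD1 r) /=; last first.
  by rewrite -subr_eq0 opprD addNKr oppr_eq0.
rewrite (bigD1 0) /=; last by rewrite eq_sym r2 eq_sym r0.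
rewrite big_pred0 ?addr0 // => i.
by case: r r0 {r2} i => [[|[|[|]]]] // r3 _ [[|[|[|]]]].
Qed.

(** The orbit of 0 under f runs through all three vertices, so the section of
f^3 at 0 collects every section of f once. Its exponent sum is 3 texp f = 0 and
its rotation is - texp f, which equals rot f on the kernel. *)
Lemma cube_section f : expsum_kernel f -> rot f != 0 ->
  exists s, [/\ wreath (f ^+ 3)%g s, rot (f ^+ 3)%g = 0,
                expsum_kernel (s 0) & rot (s 0) != 0].
Proof.
move=> [Gf Ef] f0; have [s fs Gs] := GammaBar_wreath Gf.
have Es i : expsum (s i) = texp f by have [] := expsum_section i Gf fs.
have f3 : (f ^+ 3)%g = (f * (f * f))%g by rewrite !expgS expg0 mulg1.
have [_ f2s] := wreathM fs fs; have [_ f3s] := wreathM fs f2s.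
rewrite f3; eexists; split; first exact: f3s.
- by rewrite -f3 rotX // mulr3n_Z3.
- split; first by do !apply: GammaBarM.
  rewrite !expsumM // ?Es; last exact: GammaBarM.
  by rewrite -(mulr3n_Z3 (texp f)) !mulrS mulr0n addr0.
- rewrite !rotM //; last exact: GammaBarM.
  rewrite !add0r -(sum_Z3 (fun i => rot (s i)) f0).
  suff -> : \sum_i rot (s i) = rot f by [].
  have := Ef; rewrite /expsum (texpE fs) => /eqP.
  by rewrite subr_eq0 => /eqP.
Qed.

(** Descent on n: passing to a section of the cube divides n by 3. *)
Lemma rot_neq0_order f n :
  expsum_kernel f -> rot f != 0 -> (0 < n)%N -> (f ^+ n)%g <> 1%g.
Proof.
elim/ltn_ind: n f => n IH f Nf f0 n0 fn.
have /dvdnP[m nE] : (3 %| n)%N.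
  by apply: mulrn_eq0_Z3 f0 _; rewrite -rotX ?fn //; case: Nf.
have [s [f3s f30 Ns s0]] := cube_section Nf f0.
have m0 : (0 < m)%N by move: n0; rewrite nE muln_gt0 => /andP[].
apply: (IH m _ _ Ns s0 m0); first by rewrite nE ltn_Pmulr.
have [_ fns] := wreathX m f3s f30.
apply: (wreath_inj (u := fun=> 1%g) 0 fns).
by rewrite -expgnA mulnC -nE fn; exact: wreath1.
Qed.

Lemma expsum_kernel_torsion_free : torsion_free expsum_kernel.
Proof.
move=> f Nf n n0 fn; apply: tree_aut_ext => w.
elim: w f Nf fn => [|i w IH] f Nf fn; first by have [] := tree_autP f.
have f0 : rot f = 0 by apply: contrapT => /eqP f0; exact: rot_neq0_order fn.
have [Gf Ef] := Nf; have [s fs _] := GammaBar_wreath Gf.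
have [Gs Es] := expsum_section i Gf fs.
have Ns : expsum_kernel (s i) by split=> //; rewrite Es -Ef /expsum f0 add0r.
rewrite fs f0 addr0 IH //.
have [_ fns] := wreathX n fs f0.
by apply: (wreath_inj (u := fun=> 1%g) i fns); rewrite fn; exact: wreath1.
Qed.

(** A left coset of the kernel is a fibre of expsum, and Z/3 has three
elements. *)
Lemma expsum_kernel_finite_index : finite_index GammaBar expsum_kernel.
Proof.
apply: (@sub_finite_set _ _
  [set [set f | GammaBar f /\ expsum f = c] | c in [set: 'Z_3]]).
  move=> _ [g Gg <-]; exists (expsum g) => //; apply/seteqP; split=> f /=.
    move=> [Gf Ef]; exists (g^-1 * f)%g; last by rewrite mulVKg.
    have GgV := GammaBarV Gg; split; first exact: GammaBarM.
    by rewrite expsumM // expsumV // Ef addNr.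
  move=> [h [Gh Eh] <-]; split; first exact: GammaBarM.
  by rewrite expsumM // Eh addr0.
exact/finite_image/finite_finset.
Qed.

Lemma K_sub_expsum_kernel : K `<=` expsum_kernel.
Proof.
have GaV := GammaBarV GammaBar_a.
have Et : expsum t = expsum a.
  by rewrite /expsum texp_t texp_a; apply/val_inj.
apply: smallest_sub; first exact: expsum_kernel_subgroup.
have Gt := GammaBar_t.
by move=> _ [->|->]; (split; first exact: GammaBarM);
  rewrite expsumM // expsumV ?Et ?subrr ?addNr //; exact: GammaBar_a.
Qed.

Theorem proposition7p4 : torsion_free K /\ virtually_torsion_free GammaBar.
Proof.
split=> [f /K_sub_expsum_kernel|]; first exact: expsum_kernel_torsion_free.
exists expsum_kernel; split.
- exact: expsum_kernel_subgroup.
- by move=> f [].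
- exact: expsum_kernel_finite_index.
- exact: expsum_kernel_torsion_free.
Qed.
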